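(* Let $p\equiv1\pmod{12}$ be a prime and $\eta_{12}$ a primitive character of order $12$ of $\mathbb F_p^\times$. Then for every $\lambda\in\mathbb F_p$ with $\lambda\notin\{-1,2,\tfrac12\}$ and $\lambda^2-\lambda+1\neq0$, $${}_2\mathbb P_1\!\left[\begin{matrix}\eta_{12}&\eta_{12}^5\\&\varepsilon\end{matrix};\frac{27\lambda^2(\lambda-1)^2}{4(\lambda^2-\lambda+1)^3};p\right]=\eta_{12}(-1)\,\eta_{12}^3(1-\lambda+\lambda^2)\,{}_2\mathbb P_1\!\left[\begin{matrix}\phi&\phi\\&\varepsilon\end{matrix};\lambda;p\right].$$
   Context: Here $q=p$. Every multiplicative character $\chi$ of $\mathbb F_p^\times$, including the trivial character $\varepsilon$, is extended to $\mathbb F_p$ by $\chi(0)=0$; $\phi$ is the quadratic character, $\overline\chi$ the complex-conjugate (inverse) character, and products/powers of characters are pointwise. Period function: ${}_2\mathbb P_1\!\left[\begin{matrix}A&B\\&C\end{matrix};\lambda;p\right]=\sum_{y\in\mathbb F_p}B(y)\,\overline BC(1-y)\,\overline A(1-\lambda y)$. *)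

(* Defs.v *)
From HB Require Import structures.
From mathcomp Require Import all_boot all_order all_algebra all_field.
Set Implicit Arguments. Unset Strict Implicit. Unset Printing Implicit Defensive.
Import Order.TTheory GRing.Theory Num.Theory.
Local Open Scope ring_scope.

Definition is_mchar (p : nat) (chi : 'F_p -> algC) : Prop :=
  chi 0 = 0 /\ chi 1 = 1 /\ forall x y : 'F_p, chi (x * y) = chi x * chi y.

Definition eps (p : nat) : 'F_p -> algC := fun x => if x == 0 then 0 else 1.

Definition qchar (p : nat) : 'F_p -> algC := fun x =>
  if x == 0 then 0 else if [exists y : 'F_p, y ^+ 2 == x] then 1 else -1.

(* pointwise power of a character (k >= 1) *)
Definition cpow (p : nat) (chi : 'F_p -> algC) (k : nat) : 'F_p -> algC :=
  fun x => chi x ^+ k.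

Definition mchar_of_order (p : nat) (chi : 'F_p -> algC) (n : nat) : Prop :=
  is_mchar chi /\ (forall x : 'F_p, x != 0 -> chi x ^+ n = 1) /\
  (forall k : nat, (0 < k < n)%N -> exists x : 'F_p, x != 0 /\ chi x ^+ k != 1).

Definition P21 (p : nat) (A B C : 'F_p -> algC) (lam : 'F_p) : algC :=
  \sum_(y : 'F_p) B y * ((B (1 - y))^* * C (1 - y)) * (A (1 - lam * y))^*.

(* Main.v *)
(** Write [phi = eta^6] and [omega = eta^4].  The Legendre sum is brought to
    [sum_s phi (s^3/m - 3 s + 1)] with
    [1/m = ((1+lam)(lam-2)(1-2lam))^2 / (lam^2-lam+1)^3].
    The number of [s] with [s^3/m - 3 s = tau] is
    [1 + sum_z omega (m z)] over the roots [z] of [z + m/z = tau]: Cardano's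
    formula when these are rational, while otherwise the cubic has at most one
    root and averaging over [tau] forces equality.  This 3-isogeny turns the
    Legendre sum into [H = sum_z omega (m z) phi (z + m/z + 1)].  Next,
    [phi (s+1) + phi (s-1)] is the sum of [phi w] over [w + 1/(4w) = s], so [2 H]
    is a sum over the curve [w + 1/(4w) = z + m/z]; the substitution [z = w t]
    makes [w^2] a rational function of [t], giving two sums of order 12,
    interchanged by [t -> (t - 4m)/(t - 1)], each a multiple of the left-hand
    side. *)

Require Import Defs.
From HB Require Import structures.
From mathcomp Require Import all_boot all_order all_algebra all_fingroup.
From mathcomp Require Import all_solvable all_field ring.
Import Order.TTheory GRing.Theory Num.Theory.
Set Implicit Arguments. Unset Strict Implicit. Unset Printing Implicit Defensive.
Local Open Scope ring_scope.

(** * Generators and characters of order 12 *)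

Lemma finField_generator (F : finFieldType) :
  exists2 g : F, g != 0 & forall x, x != 0 -> exists k, x = g ^+ k.
Proof.
have /cyclicP[u Du] := field_unit_group_cyclic [set: {unit F}]%G.
exists (FinRing.uval u); first by rewrite -unitfE; exact: valP u.
move=> x; rewrite -unitfE => Ux.
have /cycleP[k Dk] : FinRing.unit F Ux \in <[u]>%g by rewrite -Du inE.
by exists k; rewrite -FinRing.val_unitX -Dk.
Qed.

Section Order12.

Variables (F : finFieldType) (eta : F -> algC).
Hypotheses (two_neq0 : 2 != 0 :> F) (three_neq0 : 3 != 0 :> F).
Hypotheses (eta0 : eta 0 = 0) (eta1 : eta 1 = 1).
Hypothesis etaM : forall x y, eta (x * y) = eta x * eta y.
Hypothesis eta12 : forall x, x != 0 -> eta x ^+ 12 = 1.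
Hypothesis eta_order :
  forall k, (0 < k < 12)%N -> exists x, x != 0 /\ eta x ^+ k != 1.

Lemma etaX (x : F) n : eta (x ^+ n) = eta x ^+ n.
Proof. by elim: n => [|n IHn]; rewrite ?expr0 ?eta1 // !exprS etaM IHn. Qed.

Lemma eta0X n : eta 0 ^+ n.+1 = 0.
Proof. by rewrite eta0 expr0n. Qed.

Lemma eta_neq0 x : x != 0 -> eta x != 0.
Proof. by move/eta12; case: eqP => // -> /eqP; rewrite expr0n eq_sym oner_eq0. Qed.

Lemma etaV x : eta x^-1 = (eta x)^-1.
Proof.
have [->|x0] := eqVneq x 0; first by rewrite invr0 eta0 invr0.
by apply: (mulfI (eta_neq0 x0)); rewrite -etaM !divff ?eta_neq0.
Qed.

(** Comparisons of summands below supply [c] explicitly, which reduces them to rational identities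
    for [field]. *)
Lemma eta_mod12 c x y : c != 0 -> x = c ^+ 12 * y -> eta x = eta y.
Proof. by move=> c0 ->; rewrite etaM etaX eta12 // mul1r. Qed.

Lemma eta_conj x : (eta x)^* = eta x^-1.
Proof.
rewrite etaV; have [->|x0] := eqVneq x 0; first by rewrite eta0 conjC0 invr0.
have: `|eta x| ^+ 12 = 1 by rewrite -normrX eta12 // normr1.
move/eqP; rewrite pexpr_eq1 ?normr_ge0 // => /eqP n1.
by rewrite invC_norm n1 expr1n invr1 mul1r.
Qed.

Lemma eta_generator :
  exists g, [/\ g != 0, forall x, x != 0 -> exists k, x = g ^+ k &
                12.-primitive_root (eta g)].
Proof.
have [g g0 gen] := finField_generator F; exists g; split=> //.
apply/andP; split=> //; apply/forallP=> i; rewrite unity_rootE.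
apply/eqP; case: (ltngtP i.+1 12) => [lti|lti|->]; last exact/eqP/eta12.
- apply/negbTE/negP=> /eqP gi1.
  have [|x [/gen[k ->]]] := eta_order (k := i.+1); first by rewrite lti.
  by rewrite etaX -exprM mulnC exprM gi1 expr1n eqxx.
- by have := ltn_ord i; rewrite ltnNge -ltnS lti.
Qed.

(** A generator [g] has a primitive 12th root of unity as its value, so for [x = g ^+ j] the
    condition says that [n * k] divides [j * n], hence [k] divides [j]. This detects squares and
    cubes. *)
Lemma eta_pow_kernel n k x : (n * k = 12)%N ->
  x != 0 -> eta x ^+ n = 1 -> exists s, x = s ^+ k.
Proof.
have [g [g0 gen prim_g]] := eta_generator.
move=> nk /gen[j ->] /eqP; rewrite etaX -exprM -(prim_order_dvd prim_g) -nk.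
have n0: (0 < n)%N by case: n nk.
rewrite [(j * n)%N]mulnC dvdn_pmul2l // => /dvdnP[i ->].
by exists (g ^+ i); rewrite -exprM.
Qed.

Lemma sum_eta_pow k : (0 < k < 12)%N -> \sum_x eta x ^+ k = 0.
Proof.
move=> /eta_order[a [a0 ak]].
set S := \sum_x _; have: eta a ^+ k * S = S.
  rewrite mulr_sumr [RHS](reindex_inj (mulfI a0)) /=.
  by apply: eq_bigr => x _; rewrite etaM exprMn.
move/eqP; rewrite -subr_eq0 -{2}[S]mul1r -mulrBl mulf_eq0 subr_eq0 (negbTE ak).
by move/eqP.
Qed.

(** * The quadratic character and quadratic equations *)

Definition phi x := eta x ^+ 6.

Lemma phiM x y : phi (x * y) = phi x * phi y.
Proof. by rewrite /phi etaM exprMn. Qed.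

Lemma phi0 : phi 0 = 0. Proof. by rewrite /phi eta0 expr0n. Qed.

Lemma phi_sqr x : x != 0 -> phi (x ^+ 2) = 1.
Proof. by move=> x0; rewrite /phi etaX -exprM eta12. Qed.

Lemma phiN x : phi (- x) = phi x.
Proof.
rewrite -mulN1r phiM -[RHS]mul1r; congr (_ * _).
by rewrite /phi (exprM _ 2 3) -etaX sqrrN expr1n eta1 expr1n.
Qed.

Lemma phi_nonsquare x : (forall y, y ^+ 2 != x) -> phi x = -1.
Proof.
move=> nsq; have x0: x != 0 by apply: contraNneq (nsq 0) => ->; rewrite expr0n.
have /eqP := eta12 x0; rewrite (exprM _ 6 2) -/(phi x) sqrf_eq1 => /orP[/eqP|/eqP->//].
case/(eta_pow_kernel (erefl : (6 * 2 = 12)%N) x0) => y /eqP.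
by rewrite eq_sym (negbTE (nsq y)).
Qed.

Lemma sum_pred2 (f : F -> algC) (P : pred F) a b : a != b ->
  P =1 (fun x => (x == a) || (x == b)) -> \sum_(x | P x) f x = f a + f b.
Proof.
move=> ab DP; rewrite (bigD1 a) ?DP ?eqxx //= (bigD1 b) ?DP ?eqxx ?orbT 1?eq_sym //=.
rewrite big_pred0 ?addr0 // => x; rewrite DP.
by case: (x == a); case: (x == b).
Qed.

Lemma sum_pred3 (f : F -> algC) (P : pred F) a b c :
  a != b -> a != c -> b != c ->
  P =1 (fun x => [|| x == a, x == b | x == c]) ->
  \sum_(x | P x) f x = f a + (f b + f c).
Proof.
move=> ab ac bc DP; rewrite (bigD1 a) ?DP ?eqxx //=; congr (_ + _).
apply: sum_pred2 => // x; rewrite DP; have [->|xa] := eqVneq x a; rewrite ?andbT //.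
by rewrite (negbTE ab) (negbTE ac).
Qed.

Lemma four_sqr : 4 = 2 ^+ 2 :> F. Proof. by ring. Qed.

Lemma four_neq0 : 4 != 0 :> F.
Proof. by rewrite (natrM _ 2 2) mulf_neq0. Qed.

Hint Resolve four_neq0 : core.

Local Ltac field_nz := field; rewrite ?mulN1r ?mulNr ?oppr_eq0 ?oner_neq0 //=;
  do ?[apply/andP; split]; done.

Lemma sum_sqrt a : a != 0 -> \sum_(w | w ^+ 2 == a) 1 = 1 + phi a.
Proof.
move=> a0; case: (pickP (fun w => w ^+ 2 == a)) => [w0 /eqP Dw0 | nsq].
  have w00: w0 != 0 by apply: contraNneq a0 => w00; rewrite -Dw0 w00 expr0n.
  rewrite -{2}Dw0 phi_sqr // (@sum_pred2 _ _ w0 (- w0)) //.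
    by rewrite -subr_eq0 opprK -mulr2n -mulr_natl mulf_neq0.
  by move=> w; rewrite -Dw0 eqf_sqr.
by rewrite big_pred0 // phi_nonsquare ?subrr // => y; rewrite nsq.
Qed.

(** A root [w0] has partner [(4 * w0)^-1], and [s + 1], [s - 1] are [(w0 + 1/2)^2 / w0],
    [(w0 - 1/2)^2 / w0]; when nonzero, all agree with [w0] modulo squares. Without roots, [s^2 - 1]
    is a nonsquare and the two values on the left are opposite. *)
Lemma phi_shift s :
  phi (s + 1) + phi (s - 1) = \sum_(w | 4 * w ^+ 2 + 1 == 4 * s * w) phi w.
Proof.
case: (pickP (fun w => 4 * w ^+ 2 + 1 == 4 * s * w)) => [w0 /eqP Dw0 | no_w].
  have w00: w0 != 0.
    by apply/eqP=> w00; move/eqP: Dw0; rewrite w00 expr0n !mulr0 add0r oner_eq0.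
  have Ds: s = w0 + (4 * w0)^-1.
    by apply: (mulfI (mulf_neq0 four_neq0 w00)); rewrite -mulrAC -Dw0; field_nz.
  have roots w : (4 * w ^+ 2 + 1 == 4 * s * w) = (w == w0) || (w == (4 * w0)^-1).
    rewrite -subr_eq0 -(subr_eq0 w w0) -(subr_eq0 w (4 * w0)^-1) -mulf_eq0.
    rewrite -[RHS](mulrI_eq0 _ (mulfI four_neq0)); congr (_ == 0).
    by rewrite Ds; field_nz.
  have phiV c : c != 0 -> phi (c ^+ 2 / w0) = phi w0.
    move=> c0; have ->: c ^+ 2 / w0 = (c / w0) ^+ 2 * w0 by field_nz.
    by rewrite phiM phi_sqr ?mul1r // mulf_neq0 ?invr_eq0.
  have sp: s + 1 = (w0 + 2^-1) ^+ 2 / w0 by rewrite Ds; field_nz.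
  have sm: s - 1 = (w0 - 2^-1) ^+ 2 / w0 by rewrite Ds; field_nz.
  have rV: (4 * w0)^-1 = 2^-1 ^+ 2 / w0 by field_nz.
  (* A double root is [1/2] or [-1/2], so [s] is [1] or [-1]: one value on the left is [phi 0], the
     other is [phi] at [2] or [-2]. *)
  have [eqw|neqw] := eqVneq w0 (4 * w0)^-1.
    have: (w0 - 2^-1) * (w0 + 2^-1) = 0.
      have e: 4 * w0 ^+ 2 = 1 by rewrite expr2 {2}eqw; field_nz.
      apply: (mulfI four_neq0); rewrite mulr0.
      by transitivity (4 * w0 ^+ 2 - 1); [field_nz | rewrite e subrr].
    rewrite (eq_bigl (pred1 w0)) => [|w]; last by rewrite roots -eqw orbb.
    have phi2: phi 2 = phi 2^-1.
      by rewrite -[2 in LHS](mulfK two_neq0) phiM -expr2 phi_sqr ?mul1r.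
    rewrite big_pred1_eq => /eqP; rewrite mulf_eq0 subr_eq0 addr_eq0 => /orP[]/eqP h.
      have ->: s = 1 by rewrite Ds h; field_nz.
      by rewrite subrr phi0 addr0 h phi2.
    have ->: s = -1 by rewrite Ds h; field_nz.
    by rewrite addNr phi0 add0r -opprD !phiN h phiN -phi2.
  have w1: w0 + 2^-1 != 0.
    apply: contra_neq neqw => /eqP; rewrite addr_eq0 => /eqP->; field_nz.
  have w2: w0 - 2^-1 != 0.
    by apply: contra_neq neqw => /eqP; rewrite subr_eq0 => /eqP->; field_nz.
  by rewrite (sum_pred2 _ neqw roots) sp sm rV !phiV ?invr_eq0.
have sq: phi (s + 1) * phi (s - 1) = -1.
  rewrite -phiM phi_nonsquare // => y; apply/negP=> /eqP Dy.
  (* The quadratic formula, [y] being a square root of [s^2 - 1]. *)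
  move: (no_w ((s + y) / 2)) => /eqP; case.
  have {}Dy: y ^+ 2 = s ^+ 2 - 1 by rewrite Dy; ring.
  by field: Dy.
rewrite big_pred0 //; have s1: s + 1 != 0.
  by apply: contra_eq_neq sq => ->; rewrite phi0 mul0r eq_sym oppr_eq0 oner_eq0.
have /eqP := eta12 s1; rewrite (exprM _ 6 2) -/(phi _) sqrf_eq1.
case/orP=> /eqP e; move: sq; rewrite e.
  by rewrite mul1r => ->; rewrite subrr.
by rewrite mulN1r => /oppr_inj->; rewrite addNr.
Qed.

(** * From the twisted sum to sums of order 12 *)

Lemma twisted_sum_double m : m != 0 ->
  (\sum_z eta (m * z) ^+ 4 * phi (z + m / z + 1)) *+ 2 =
  \sum_t eta (m * t) ^+ 4 *
    (eta ((t - 4 * m) / (4 * t * (t - 1))) ^+ 5 +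
     eta ((t - 4 * m) / (4 * t * (t - 1))) ^+ 11).
Proof.
move=> m0; pose Q z w := 4 * w ^+ 2 + 1 == 4 * (z + m / z) * w.
pose T z w := eta (m * z) ^+ 4 * phi w.
have T0 z w : z * w = 0 -> T z w = 0.
  move/eqP; rewrite mulf_eq0 => /orP[]/eqP->; rewrite /T ?mulr0 ?phi0 ?mulr0 //.
  by rewrite eta0X mul0r.
transitivity (\sum_z \sum_(w | Q z w) T z w).
  (* Replacing [z] by [-z] in one copy turns [phi (s + 1)] into [phi (s - 1)] for [s = z + m / z],
     because [eta ^+ 4] and [phi] are even. *)
  rewrite mulr2n {2}(reindex_inj oppr_inj) -big_split; apply: eq_bigr => z _ /=.
  rewrite -mulr_sumr -phi_shift mulrDr; congr (_ + _).
  rewrite mulrN -!(etaX _ 4) (exprM (- _) 2 2) sqrrN -exprM.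
  by rewrite -(phiN (_ - 1)) !opprD opprK invrN mulrN.
rewrite (exchange_big_dep xpredT) //=.
transitivity (\sum_w \sum_(t | Q (w * t) w) T (w * t) w).
  apply: eq_bigr => w _; have [->|w0] := eqVneq w 0.
    by rewrite !big1 // => *; rewrite T0 ?mulr0.
  by rewrite (reindex_inj (mulfI w0)).
rewrite (exchange_big_dep xpredT) //=; apply: eq_bigr => t _.
set R := _ / _; have [->|t0] := eqVneq t 0.
  rewrite big1 => [|w _]; last by rewrite T0 ?mulr0 ?mul0r.
  by rewrite mulr0 eta0X mul0r.
(* The exponent 10 is 4 + 6, from [eta ^+ 4] at [w * t] and [phi] at [w]; being even, it yields a
   function of [w ^+ 2]. *)
transitivity (\sum_(w | 4 * t * (t - 1) * w ^+ 2 == t - 4 * m)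
                eta (m * t) ^+ 4 * eta w ^+ 10).
  rewrite big_mkcond [RHS]big_mkcond; apply: eq_bigr => w _.
  have [->|w0] := eqVneq w 0; first by rewrite T0 ?mulr0 // eta0X mulr0 !if_same.
  have ->: Q (w * t) w = (4 * t * (t - 1) * w ^+ 2 == t - 4 * m).
    rewrite /Q -subr_eq0 -(subr_eq0 (_ * _)) -[LHS](mulrI_eq0 _ (mulfI t0)) -oppr_eq0.
    by congr (_ == 0); field_nz.
  by case: ifP => // _; rewrite /T /phi !etaM !exprMn; ring.
rewrite -mulr_sumr; congr (_ * _); rewrite /R.
(* At [t = 1] the condition does not involve [w]: the sum is a complete sum of [eta ^+ 10] or empty.
   On the right, division by zero gives [eta 0]. *)
have [->|t1] := eqVneq t 1.
  rewrite subrr mulr0 invr0 mulr0 !eta0X addr0.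
  under eq_bigl => w do rewrite mul0r.
  by case: eqP => _; [exact: sum_eta_pow | rewrite big_pred0].
have D0: 4 * t * (t - 1) != 0 by rewrite !mulf_neq0 // subr_eq0.
rewrite -/R (eq_bigl (fun w => w ^+ 2 == R)) => [|w]; last first.
  by rewrite -[RHS](inj_eq (mulfI D0)) /R [_ * (_ / _)]mulrC divfK.
transitivity (eta R ^+ 5 * \sum_(w | w ^+ 2 == R) 1).
  by rewrite mulr_sumr; apply: eq_bigr => w /eqP <-; rewrite mulr1 etaX -exprM.
have [->|R0] := eqVneq R 0; first by rewrite !eta0X mul0r addr0.
by rewrite sum_sqrt // mulrDr mulr1 /phi -exprD.
Qed.

(** Let [R] be the common argument. The involution sending [t] to [(t - M) / (t - 1) = 4 t R] takes
    [R] to [1 / (16 R)], which exchanges the exponents 5 and 11 modulo twelfth powers. *)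
Lemma twisted_sum_branches M :
  \sum_t eta t ^+ 4 * eta ((t - M) / (4 * t * (t - 1))) ^+ 5 =
  \sum_t eta t ^+ 4 * eta ((t - M) / (4 * t * (t - 1))) ^+ 11.
Proof.
(* At [M = 1] the involution degenerates to a constant. There each sum is a complete character sum
   lacking its term at 1, hence minus that term; the constants differ by the factor [4^6 = 2^12]. *)
have [->|M1] := eqVneq M 1.
  have drop1 c k : (0 < k < 12)%N ->
      \sum_t (if t == 1 then 0 else eta c * eta t ^+ k) = - eta c.
    move=> /sum_eta_pow; rewrite (bigD1 1) //= eta1 expr1n => /eqP.
    rewrite addrC addr_eq0 => /eqP e.
    rewrite (bigD1 1) //= eqxx add0r -mulrN1 -e mulr_sumr.
    by apply: eq_bigr => t /negbTE->.
  transitivity (- eta (4 ^- 5)); last transitivity (- eta (4 ^- 11)).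
  - rewrite -(drop1 _ 11%N) //; apply: eq_bigr => t _; case: eqP => [->|/eqP t1].
      by rewrite subrr mul0r eta0X mulr0.
    have t10: t - 1 != 0 by rewrite subr_eq0.
    have [->|t0] := eqVneq t 0; first by rewrite !eta0X !(mulr0, mul0r).
    rewrite -!etaX -!etaM; apply: (@eta_mod12 t^-1); first by rewrite invr_eq0.
    (* Abstracting the numeral keeps [field] from asking that 4 ^ 5 and the like,
       computed in unary, be nonzero. *)
    by move: (4 : F) four_neq0 => q q0; field_nz.
  - congr (- _); apply: (@eta_mod12 2) => //; rewrite four_sqr.
    by move: (2 : F) two_neq0 => q q0; field_nz.
  - rewrite -(drop1 _ 5%N) //; apply: eq_bigr => t _; case: eqP => [->|/eqP t1].
      by rewrite subrr mul0r eta0X mulr0.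
    have t10: t - 1 != 0 by rewrite subr_eq0.
    have [->|t0] := eqVneq t 0; first by rewrite !eta0X !(mulr0, mul0r).
    rewrite -!etaX -!etaM; apply: (@eta_mod12 t) => //.
    by move: (4 : F) four_neq0 => q q0; field_nz.
(* The map exchanges 1 and infinity; fixing 1 makes it a permutation of [F]. *)
pose h t := if t == 1 then 1 else (t - M) / (t - 1).
have hK: involutive h.
  move=> t; rewrite /h; have [->|t1] := eqVneq t 1; first by rewrite eqxx.
  have t10: t - 1 != 0 by rewrite subr_eq0.
  have M10: 1 - M != 0 by rewrite subr_eq0 eq_sym.
  case: eqP => [e|_].
    have: t - M = t - 1 by rewrite -[RHS]mul1r -[X in X * _]e divfK.
    by move/addrI/oppr_inj/eqP; rewrite (negbTE M1).
  have d: t - M - (t - 1) != 0 by rewrite (_ : _ - _ = 1 - M) //; ring.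
  by field_nz.
rewrite (reindex_inj (inv_inj hK)); apply: eq_bigr => t _ /=; rewrite /h.
have [->|t1] := eqVneq t 1; first by rewrite subrr mulr0 invr0 mulr0 !eta0X.
have t10: t - 1 != 0 by rewrite subr_eq0.
have M10: 1 - M != 0 by rewrite subr_eq0 eq_sym.
have [->|t0] := eqVneq t 0.
  have ->: (0 - M) / (0 - 1) = M by field_nz.
  by rewrite subrr mul0r !eta0X !(mulr0, mul0r).
have [->|tM] := eqVneq t M; first by rewrite subrr !mul0r !eta0X !(mulr0, mul0r).
have tM0: t - M != 0 by rewrite subr_eq0.
(* This witness is [1 / (2 R)]. *)
rewrite -!etaX -!etaM; apply: (@eta_mod12 (2 * t * (t - 1) / (t - M))).
  by rewrite !mulf_neq0 ?invr_eq0.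
have ->: (t - M) / (t - 1) - 1 = (1 - M) / (t - 1) by field_nz.
have ->: (t - M) / (t - 1) - M = t * (1 - M) / (t - 1) by field_nz.
by rewrite four_sqr; move: (2 : F) two_neq0 => q q0; field_nz.
Qed.

(** The two branches are equal, so the factor 2 cancels. The branch of exponent 11 is kept, since
    [R^11] is [1 / R] modulo twelfth powers. *)
Lemma twisted_sumE m : m != 0 ->
  \sum_z eta (m * z) ^+ 4 * phi (z + m / z + 1) =
  eta (4 * m ^+ 4) * \sum_t eta (t ^+ 5 * (t - 1) / (t - 4 * m)).
Proof.
move=> m0; have /eqP := twisted_sum_double m0.
under [X in _ == X]eq_bigr => t _ do rewrite etaM exprMn -[_ * _ * (_ + _)]mulrA mulrDr.
rewrite -mulr_sumr big_split /= twisted_sum_branches -mulr2n mulrnAr.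
rewrite eqr_pMn2r // => /eqP->; rewrite etaM etaX [eta 4 * _]mulrC -[RHS]mulrA.
congr (_ * _); rewrite mulr_sumr; apply: eq_bigr => t _.
have [->|t0] := eqVneq t 0; first by rewrite !(expr0n, mul0r, eta0, mulr0).
have [->|tM] := eqVneq t (4 * m).
  by rewrite subrr invr0 !(mul0r, mulr0, eta0X, eta0).
have [->|t1] := eqVneq t 1; first by rewrite subrr !(mulr0, invr0, mul0r, eta0X, eta0).
have t10: t - 1 != 0 by rewrite subr_eq0.
have tM0: t - 4 * m != 0 by rewrite subr_eq0.
rewrite -!etaX -!etaM.
apply: (@eta_mod12 ((t - 4 * m) / (4 * t * (t - 1)))).
  by rewrite !(mulf_neq0, invr_eq0).
by move: (4 : F) four_neq0 tM0 => q q0 tM0; field_nz.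
Qed.

(** Under [t = y / (y - 1)] the arguments of [eta] agree exactly, the factor [- M] included. *)
Lemma hypergeometric_involution M : M != 0 ->
  \sum_y eta (y ^+ 5 / (1 - y) ^+ 5 / (1 - (1 - M^-1) * y)) =
  eta (- M) * \sum_t eta (t ^+ 5 * (t - 1) / (t - M)).
Proof.
move=> M0; pose h t : F := if t == 1 then 1 else t / (t - 1).
have hK: involutive h.
  move=> t; rewrite /h; have [->|t1] := eqVneq t 1; first by rewrite eqxx.
  have t10: t - 1 != 0 by rewrite subr_eq0.
  have d: t - (t - 1) != 0 by rewrite (_ : _ - _ = 1) ?oner_neq0 //; ring.
  case: eqP => [e|_]; last by field_nz.
  have: t + 0 = t - 1 by rewrite addr0 -[RHS]mul1r -[X in X * _]e divfK.
  by move/addrI/eqP; rewrite eq_sym oppr_eq0 oner_eq0.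
rewrite mulr_sumr [RHS](reindex_inj (inv_inj hK)); apply: eq_bigr => y _ /=.
rewrite /h -etaM; have [->|y1] := eqVneq y 1.
  by rewrite !subrr expr0n invr0 !(mulr0, mul0r).
have y10: y - 1 != 0 by rewrite subr_eq0.
have y01: 1 - y != 0 by rewrite subr_eq0 eq_sym.
(* If this quantity vanishes, both arguments are 0 by the convention for the inverse of 0. *)
congr (eta _); have [e|e] := eqVneq (y - M * (y - 1)) 0.
  have ->: 1 - (1 - M^-1) * y = (y - M * (y - 1)) / M by field_nz.
  have ->: y / (y - 1) - M = (y - M * (y - 1)) / (y - 1) by field_nz.
  by rewrite e !mul0r invr0 !mulr0.
by field_nz.
Qed.

(** * Cube roots of unity and the fibers of the cubic *)

(** Otherwise cubing is injective, so every element is a cube and [eta ^+ 4] is trivial on nonzero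
    elements, against the order of [eta]. *)
Lemma cube_root_unity : exists2 z : F, z ^+ 2 = - z - 1 & z != 1.
Proof.
have [/existsP[z /andP[/eqP z3 z1]]|no_z] :=
    boolP [exists z : F, (z ^+ 3 == 1) && (z != 1)].
  exists z => //; apply/eqP; rewrite -subr_eq0.
  have: (z - 1) * (z ^+ 2 + z + 1) == 0.
    by rewrite (_ : _ * _ = z ^+ 3 - 1); [rewrite z3 subrr | ring].
  by rewrite mulf_eq0 (subr_eq0 z) (negbTE z1) /= (_ : z ^+ 2 - _ = z ^+ 2 + z + 1) //; ring.
have inj3: injective (fun x : F => x ^+ 3).
  move=> x y /= exy; have [y0|y0] := eqVneq y 0.
    by apply/eqP; move/eqP: exy; rewrite y0 [0 ^+ 3]expr0n expf_eq0.
  apply: (mulIf (invr_neq0 y0)); rewrite divff //; apply/eqP.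
  apply: contraNT no_z => xy1; apply/existsP; exists (x / y).
  by rewrite xy1 expr_div_n exy divff ?expf_neq0 ?eqxx.
have [x [x0]] := eta_order (isT : (0 < 4 < 12)%N).
have [f fK Kf] := injF_bij inj3.
rewrite -(Kf x) etaX -exprM eta12 ?eqxx //.
by apply: contraNneq x0 => fx0; rewrite -(Kf x) fx0 expr0n.
Qed.

Lemma phi3 : phi 3 = 1.
Proof.
have [z Dz _] := cube_root_unity.
have D3: - 3 = (2 * z + 1) ^+ 2 by ring: Dz.
rewrite -phiN D3 phi_sqr //; apply: contraNneq three_neq0 => e.
by rewrite -oppr_eq0 D3 e expr0n.
Qed.

Lemma cubic_roots (a b z s : F) : z ^+ 2 = - z - 1 ->
  (s ^+ 3 - 3 * (a * b) * s == a ^+ 3 + b ^+ 3) =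
  [|| s == a + b, s == z * a + z ^+ 2 * b | s == z ^+ 2 * a + z * b].
Proof.
move=> Dz; rewrite -!(subr_eq0 s) -!mulf_eq0 -subr_eq0; congr (_ == 0).
by rewrite Dz; ring: Dz.
Qed.

(** The roots [z0] and [m / z0] give arguments with product [m^3], so their [eta ^+ 4] values are
    inverse cube roots of unity. For distinct roots both sides are 3 or 0 according as [m * z0] is a
    cube or not; for a double root both are 2. *)
Lemma cubic_fiber_split (m tau z0 : F) : m != 0 -> z0 ^+ 2 + m = tau * z0 ->
  \sum_(s | s ^+ 3 - 3 * m * s == m * tau) 1 =
  1 + \sum_(z | z ^+ 2 + m == tau * z) eta (m * z) ^+ 4 :> algC.
Proof.
have [j Dj j1] := cube_root_unity.
move=> m0 Dz0; have z00: z0 != 0.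
  by apply: contraNneq m0 => z00; move: Dz0; rewrite z00 expr0n mulr0 add0r => ->.
have Dtau: tau = z0 + m / z0.
  by apply: (mulIf z00); rewrite -Dz0; field_nz.
have roots z : (z ^+ 2 + m == tau * z) = (z == z0) || (z == m / z0).
  rewrite -!(subr_eq0 z) -mulf_eq0 -subr_eq0 Dtau; congr (_ == 0); field_nz.
have [Dm|z01] := eqVneq z0 (m / z0).
  have {}Dm: m = z0 * z0 by rewrite {2}Dm; field_nz.
  rewrite [X in 1 + X](eq_bigl (pred1 z0)) => [|z]; last by rewrite roots Dm mulfK ?orbb.
  rewrite big_pred1_eq Dtau Dm (_ : z0 * z0 * z0 = z0 ^+ 3); last by ring.
  rewrite etaX -exprM eta12 // (@sum_pred2 _ _ (z0 + z0) (- z0)) //.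
    by rewrite -subr_eq0 (_ : _ - _ = 3 * z0) ?mulf_neq0 //; ring.
  move=> s /=; rewrite (_ : _ * (_ + _) = z0 ^+ 3 + z0 ^+ 3); last by field_nz.
  rewrite (cubic_roots _ _ _ Dj) -mulrDl orbC -mulrDl [j ^+ 2 + j]addrC orbb.
  by rewrite orbC (_ : j + j ^+ 2 = -1) ?mulN1r // Dj; ring.
rewrite (sum_pred2 _ z01 roots).
have mz0: m * z0 != 0 by rewrite mulf_neq0.
have [w1|w1] := eqVneq (eta (m * z0) ^+ 4) 1.
  (* Cardano: the roots are a + b and its twists by cube roots of unity. *)
  have [a Da] := eta_pow_kernel (erefl : (4 * 3 = 12)%N) mz0 w1.
  have a0: a != 0 by apply: contraNneq mz0; rewrite Da => ->; rewrite expr0n.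
  pose b := m / a.
  have b0: b != 0 by rewrite mulf_neq0 ?invr_eq0.
  have Dm: m = a * b by rewrite /b; field_nz.
  have Db: m * (m / z0) = b ^+ 3.
    by apply: (mulIf mz0); rewrite [in RHS]Da -exprMn [b * a]mulrC -Dm; field_nz.
  rewrite w1 Db -etaX -exprM etaX eta12 //.
  have Dmtau: m * tau = a ^+ 3 + b ^+ 3 by rewrite Dtau mulrDr Da Db.
  have ab3: a ^+ 3 != b ^+ 3 by rewrite -Da -Db (inj_eq (mulfI m0)).
  have neq (x y : F) : x ^+ 3 = a ^+ 3 -> y ^+ 3 = b ^+ 3 -> x != y.
    by move=> xa yb; apply: contraNneq ab3 => xy; rewrite -xa -yb xy.
  have j3: j ^+ 3 = 1 by ring: Dj.
  have j10: 1 - j != 0 by rewrite subr_eq0 eq_sym.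
  have j0: j != 0 by apply: contra_eq_neq j3 => ->; rewrite expr0n eq_sym oner_neq0.
  have cubeM (c x : F) : c ^+ 3 = 1 -> (c * x) ^+ 3 = x ^+ 3.
    by move=> e; rewrite exprMn e mul1r.
  have j23: (j ^+ 2) ^+ 3 = 1 by rewrite -exprM mulnC exprM j3 expr1n.
  rewrite (@sum_pred3 _ _ (a + b) (j * a + j ^+ 2 * b) (j ^+ 2 * a + j * b)) //.
  - rewrite -subr_eq0 (_ : _ - _ = (1 - j) * (a - j ^+ 2 * b)); last by ring: Dj.
    by rewrite mulf_neq0 // subr_eq0; apply: neq (erefl _) (cubeM _ _ j23).
  - rewrite -subr_eq0 (_ : _ - _ = (1 - j) * (b - j ^+ 2 * a)); last by ring: Dj.
    by rewrite mulf_neq0 // subr_eq0 eq_sym; apply: neq (cubeM _ _ j23) (erefl _).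
  - rewrite -subr_eq0 (_ : _ - _ = j * (1 - j) * (a - b)); last by ring: Dj.
    by rewrite !mulf_neq0 // subr_eq0; apply: neq.
  by move=> s; rewrite Dmtau {1}Dm (cubic_roots _ _ _ Dj).
(* Here [m * z0] is not a cube, and the right side is [1 + w + w^2 = 0]. *)
have w3: eta (m * z0) ^+ 4 * eta (m * (m / z0)) ^+ 4 = 1.
  rewrite -exprMn -etaM (_ : m * z0 * (m * (m / z0)) = m ^+ 3); last by field_nz.
  by rewrite etaX -exprM eta12.
have w13: (eta (m * z0) ^+ 4) ^+ 3 = 1 by rewrite -exprM eta12.
have w1' := w1; move: w1 w3 w13.
move: (eta (m * z0) ^+ 4) (eta (m * (m / z0)) ^+ 4) => w w' w1 ww' w3.
have ->: 1 + (w + w') = 0.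
  have ->: w' = w ^+ 2 by rewrite -[LHS]mul1r -w3 exprSr -mulrA ww' mulr1.
  apply: (mulfI (_ : w - 1 != 0)); first by rewrite subr_eq0.
  by transitivity (w ^+ 3 - 1); [ring | rewrite w3 subrr mulr0].
rewrite big_pred0 // => s; apply/negP=> /eqP Ds.
have d0: z0 - m / z0 != 0 by rewrite subr_eq0.
(* Both sides equal [(m tau)^2 - 4 m^3]. Hence a root [s] makes [s^2 - 4 m] a square, so [s = a + b]
   with [a * b = m] in [F], and [m * z0] would be the cube of [a] or [b]. *)
have disc: (s ^+ 2 - 4 * m) * (s ^+ 2 - m) ^+ 2 = (m * (z0 - m / z0)) ^+ 2.
  transitivity ((m * tau) ^+ 2 - 4 * m ^+ 3); first by rewrite -Ds; ring.
  by rewrite Dtau; field_nz.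
have sm0: s ^+ 2 - m != 0.
  apply: contra_eq_neq disc => ->; rewrite expr0n mulr0 eq_sym.
  by rewrite expf_neq0 // mulf_neq0.
pose r := m * (z0 - m / z0) / (s ^+ 2 - m).
have Dr: r ^+ 2 = s ^+ 2 - 4 * m.
  by rewrite /r expr_div_n -disc mulfK ?expf_neq0.
pose a := (s + r) / 2; pose b := (s - r) / 2.
have Dab: a * b = m.
  by transitivity ((s ^+ 2 - r ^+ 2) / 4); [rewrite /a /b | rewrite Dr]; field_nz.
have Dab3: a ^+ 3 + b ^+ 3 = m * tau.
  rewrite -Ds -Dab (_ : s = a + b); first by ring.
  by rewrite /a /b; field_nz.
have: (m * z0 - a ^+ 3) * (m * z0 - b ^+ 3) = 0.
  transitivity ((m * z0) ^+ 2 - (a ^+ 3 + b ^+ 3) * (m * z0) + (a * b) ^+ 3); first by ring.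
  by rewrite Dab3 Dab Dtau; field_nz.
have not_cube c : m * z0 <> c ^+ 3.
  move=> Dc; case/eqP: w1'; rewrite Dc etaX -exprM eta12 //.
  by apply: contraNneq mz0; rewrite Dc => ->; rewrite expr0n.
by move/eqP; rewrite mulf_eq0 !subr_eq0 => /orP[]/eqP; apply: not_cube.
Qed.

(** Two distinct roots [s], [t] force the third, [- s - t], into [F], so the discriminant of the
    cubic is a square. As [-3] is a square, the quadratic would then split. *)
Lemma cubic_fiber_nonsplit (m tau : F) : m != 0 ->
  (forall z, z ^+ 2 + m != tau * z) ->
  \sum_(s | s ^+ 3 - 3 * m * s == m * tau) 1 <= 1 :> algC.
Proof.
move=> m0 no_z; have [j Dj _] := cube_root_unity.
have j30: 2 * j + 1 != 0.
  apply: contraNneq three_neq0 => e; rewrite -oppr_eq0.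
  by rewrite (_ : - 3 = (2 * j + 1) ^+ 2); [rewrite e expr0n | ring: Dj].
case: (pickP (fun s => s ^+ 3 - 3 * m * s == m * tau)) => [s /eqP Ds | no_s]; last first.
  by rewrite big_pred0 // ler01.
rewrite (bigD1 s) /= ?Ds // big_pred0 ?addr0 // => t; apply/negP=> /andP[/eqP Dt ts].
have ts0: t - s != 0 by rewrite subr_eq0.
have Dm: 3 * m = s ^+ 2 + s * t + t ^+ 2.
  apply: (mulfI ts0); transitivity (t ^+ 3 - s ^+ 3); last by ring.
  apply/eqP; rewrite -subr_eq0; apply/eqP.
  by transitivity (m * tau - m * tau); [rewrite -{1}Ds -Dt; ring | ring].
(* The discriminant of the cubic is -3 times a square times that of the quadratic. *)
pose D := (s - t) * (2 * s + t) * (s + 2 * t) / (3 * m * (2 * j + 1)).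
pose z := (tau + D) / 2.
have Dtau: tau = - (s * t * (s + t)) / m.
  apply: (mulfI m0); rewrite -Ds Dm; field_nz.
have jj: (2 * j + 1) ^+ 2 = -3 by ring: Dj.
have DD: D ^+ 2 = tau ^+ 2 - 4 * m.
  have X2: ((s - t) * (2 * s + t) * (s + 2 * t)) ^+ 2 =
           4 * (3 * m) ^+ 3 - 3 ^+ 3 * (s * t * (s + t)) ^+ 2 by rewrite Dm; ring.
  rewrite /D expr_div_n X2 [(3 * m * _) ^+ 2]exprMn jj Dtau.
  by move: (3 : F) three_neq0 => q q0; field_nz.
move: (no_z z) => /eqP; case; apply/eqP; rewrite -subr_eq0; apply/eqP.
transitivity ((D ^+ 2 - (tau ^+ 2 - 4 * m)) / 4); first by rewrite /z; field_nz.
by rewrite DD subrr mul0r.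
Qed.

Lemma cubic_fiber_sum (m : F) (G : F -> algC) : m != 0 ->
  \sum_tau G tau * (\sum_(s | s ^+ 3 - 3 * m * s == m * tau) 1) =
  \sum_s G (s ^+ 3 / m - 3 * s).
Proof.
move=> m0; pose f s := s ^+ 3 / m - 3 * s.
rewrite [RHS](partition_big f xpredT) //=; apply: eq_bigr => tau _.
rewrite mulr_sumr; apply: eq_big => [s | s /eqP Ds]; last first.
  by rewrite mulr1; congr (G _); apply: (mulfI m0); rewrite -Ds; field_nz.
by rewrite -[RHS](inj_eq (mulfI m0)) /f; congr (_ == _); field_nz.
Qed.

Lemma quadratic_fiber_sum (m : F) (G : F -> algC) :
  \sum_tau G tau * (\sum_(z | z ^+ 2 + m == tau * z) eta (m * z) ^+ 4) =
  \sum_z eta (m * z) ^+ 4 * G (z + m / z).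
Proof.
rewrite [RHS](partition_big (fun z => z + m / z) xpredT) //=.
apply: eq_bigr => tau _; rewrite mulr_sumr big_mkcond [RHS]big_mkcond /=.
apply: eq_bigr => z _; have [->|z0] := eqVneq z 0.
  by rewrite !mulr0 eta0X mulr0 mul0r !if_same.
rewrite -[z + _ == _](inj_eq (mulIf z0)).
rewrite (_ : (z + m / z) * z = z ^+ 2 + m); last by field_nz.
case: eqP => // e; rewrite mulrC; congr (_ * G _).
by apply: (mulIf z0); rewrite -e; field_nz.
Qed.

(** The right side dominates the left for each [tau], and both total the size of [F], because the
    twisted part adds up to a multiple of the complete sum of [eta ^+ 4]. *)
Lemma cubic_fiber (m tau : F) : m != 0 ->
  \sum_(s | s ^+ 3 - 3 * m * s == m * tau) 1 =
  1 + \sum_(z | z ^+ 2 + m == tau * z) eta (m * z) ^+ 4 :> algC.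
Proof.
move=> m0; pose N tau : algC := \sum_(s | s ^+ 3 - 3 * m * s == m * tau) 1.
pose W tau := 1 + \sum_(z | z ^+ 2 + m == tau * z) eta (m * z) ^+ 4.
have NleW t : 0 <= W t - N t.
  rewrite subr_ge0; case: (pickP (fun z => z ^+ 2 + m == t * z)) => [z /eqP Dz|no_z].
    by rewrite /N (cubic_fiber_split m0 Dz).
  by rewrite /W big_pred0 // addr0 cubic_fiber_nonsplit // => z; rewrite no_z.
suff: \sum_t (W t - N t) = 0.
  move/eqP; rewrite psumr_eq0 // => /allP/(_ tau (mem_index_enum _)).
  by rewrite subr_eq0 => /eqP.
have sumN: \sum_t N t = \sum_(t : F) 1.
  by rewrite -(cubic_fiber_sum (fun=> 1) m0); apply: eq_bigr => t _; rewrite mul1r.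
have sumW: \sum_t \sum_(z | z ^+ 2 + m == t * z) eta (m * z) ^+ 4 = 0.
  transitivity (eta m ^+ 4 * \sum_z eta z ^+ 4); last by rewrite sum_eta_pow ?mulr0.
  rewrite mulr_sumr; transitivity (\sum_z eta (m * z) ^+ 4 * 1).
    rewrite -(quadratic_fiber_sum m (fun=> 1)).
    by apply: eq_bigr => t _; rewrite mul1r.
  by apply: eq_bigr => z _; rewrite mulr1 etaM exprMn.
rewrite sumrB big_split /= sumN sumW.
by rewrite addr0 subrr.
Qed.

(** The constant 1 in the fiber count contributes a complete sum of [phi], which is 0. *)
Lemma cubic_sum_twisted (m : F) : m != 0 ->
  \sum_s phi (s ^+ 3 / m - 3 * s + 1) =
  \sum_z eta (m * z) ^+ 4 * phi (z + m / z + 1).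
Proof.
move=> m0; rewrite -(cubic_fiber_sum (fun tau => phi (tau + 1)) m0).
rewrite -(quadratic_fiber_sum m (fun tau => phi (tau + 1))).
under eq_bigr => tau _ do rewrite cubic_fiber // mulrDr mulr1.
rewrite big_split /= [X in X + _](_ : _ = 0) ?add0r //.
rewrite -[RHS](sum_eta_pow (isT : (0 < 6 < 12)%N)) [RHS](reindex_inj (addIr 1)).
by apply: eq_bigr.
Qed.

(** * The Legendre family and its comparison with order 12 *)

(** Inverting [y] gives [x (x - 1) (x - lam)] up to squares. Shifting by [(1 + lam) / 3] removes the
    quadratic term, and the scale [B / (3 L)] makes the linear and constant coefficients
    proportional to [-3] and 1. *)
Lemma legendre_sum (lam : F) :
  let L := lam ^+ 2 - lam + 1 in
  let B := (1 + lam) * (lam - 2) * (1 - 2 * lam) in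
  L != 0 -> B != 0 ->
  \sum_y phi (y * (1 - y) * (1 - lam * y)) =
  phi B * \sum_s phi (s ^+ 3 / (L ^+ 3 / B ^+ 2) - 3 * s + 1).
Proof.
move=> L B L0 B0; transitivity (\sum_x phi (x * (x - 1) * (x - lam))).
  rewrite (reindex_inj invr_inj); apply: eq_bigr => x _ /=.
  have [->|x0] := eqVneq x 0; first by rewrite invr0 !mul0r.
  rewrite (_ : _ * _ = (x ^- 2) ^+ 2 * (x * (x - 1) * (x - lam))); last by field_nz.
  by rewrite phiM phi_sqr ?mul1r // invr_eq0 expf_neq0.
pose k := B / (3 * L).
have k0: k != 0 by rewrite /k mulf_neq0 ?invr_eq0 ?(mulf_neq0 three_neq0).
rewrite (reindex_inj (addIr ((1 + lam) / 3))) (reindex_inj (mulfI k0)) mulr_sumr.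
apply: eq_bigr => s _; rewrite -phiM /=.
(* Clearing the denominators 3 in the cubic costs a factor 27, invisible to [phi]. *)
have phi27: phi (3 ^- 3) = 1.
  rewrite (_ : 3 ^- 3 = (3 ^- 2) ^+ 2 * 3).
    by rewrite phiM phi3 mulr1 phi_sqr // invr_eq0 expf_neq0.
  by move: (3 : F) three_neq0 => q q0; field_nz.
rewrite -[RHS]mul1r -phi27 -phiM; congr phi.
pose u := B / L * s; pose v := u + (1 + lam).
have ->: k * s + (1 + lam) / 3 = v / 3 by rewrite /k /v /u; field_nz.
have ->: B * (s ^+ 3 / (L ^+ 3 / B ^+ 2) - 3 * s + 1) = u ^+ 3 - 3 * L * u + B.
  by rewrite /u; field_nz.
have ->: u ^+ 3 - 3 * L * u + B = v * (v - 3) * (v - 3 * lam).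
  by rewrite /v /B /L; ring.
by move: (3 : F) three_neq0 => q q0; field_nz.
Qed.

(** The identity [4 L^3 - B^2 = 27 lam^2 (lam - 1)^2] makes [J] equal to [1 - 1 / (4 m)], so both
    sides reduce to the same sum with [M = 4 m]. *)
Lemma order12_hypergeometric (lam : F) :
  (1 + lam) * (lam - 2) * (1 - 2 * lam) != 0 -> lam ^+ 2 - lam + 1 != 0 ->
  let J := 27 * lam ^+ 2 * (lam - 1) ^+ 2 / (4 * (lam ^+ 2 - lam + 1) ^+ 3) in
  \sum_y eta (y ^+ 5 / (1 - y) ^+ 5 / (1 - J * y)) =
  eta (-1) * eta (lam ^+ 2 - lam + 1) ^+ 3 *
    \sum_y phi (y * (1 - y) * (1 - lam * y)).
Proof.
move=> B0 L0 J; rewrite legendre_sum //.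
set L := lam ^+ 2 - lam + 1 in L0 J *; set B := _ * _ * _ in B0 *.
pose m := L ^+ 3 / B ^+ 2.
have m0: m != 0 by rewrite mulf_neq0 ?invr_eq0 ?expf_neq0.
rewrite cubic_sum_twisted // twisted_sumE //.
have ->: J = 1 - (4 * m)^-1.
  rewrite /J (_ : 27 * _ * _ = 4 * L ^+ 3 - B ^+ 2); last by rewrite /L /B; ring.
  by rewrite /m; field_nz.
rewrite hypergeometric_involution; last by rewrite mulf_neq0.
rewrite -/m [RHS]mulrA [RHS]mulrA; congr (_ * _).
(* Since [m^3 B^6 = L^9], the constants differ by [L^12]. *)
rewrite /phi -!etaX -!etaM; symmetry; apply: (eta_mod12 L0).
by rewrite /m; field_nz.
Qed.

End Order12.

(** * Transfer to the prime field *)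

Lemma qcharE (p : nat) (eta : 'F_p -> algC) : mchar_of_order eta 12 ->
  @qchar p =1 phi eta.
Proof.
case=> [[eta0 [eta1 etaM]] [eta12 etaO]] x; rewrite /qchar.
have [->|x0] := eqVneq x 0; first by rewrite phi0.
case: existsP => [[y /eqP Dy]|no_y].
  by rewrite -Dy phi_sqr //; apply: contraNneq x0 => y0; rewrite -Dy y0 expr0n.
rewrite (phi_nonsquare eta1 etaM eta12 etaO) // => y.
by apply/negP=> Dy; case: no_y; exists y.
Qed.

Theorem mainTheorem18 (p : nat) (eta : 'F_p -> algC) (lam : 'F_p) :
  prime p -> (p %% 12 = 1)%N ->
  mchar_of_order eta 12 ->
  lam != -1 -> lam != 2%:R -> lam != (2%:R)^-1 ->
  lam ^+ 2 - lam + 1 != 0 ->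
  P21 eta (cpow eta 5) (@eps p)
      (27%:R * lam ^+ 2 * (lam - 1) ^+ 2 / (4%:R * (lam ^+ 2 - lam + 1) ^+ 3))
  = eta (-1) * cpow eta 3 (1 - lam + lam ^+ 2)
    * P21 (@qchar p) (@qchar p) (@eps p) lam.
Proof.
move=> p_prime p12 eta_ord lam1 lam2 lam_half L0.
have qE := qcharE eta_ord; case: (eta_ord) => [[eta0 [eta1 etaM]] [eta12 etaO]].
have p_dvd n : (n %:R == 0 :> 'F_p) = (p %| n)%N.
  by rewrite -(dvdn_pcharf (pchar_Fp p_prime)).
have two_neq0: 2 != 0 :> 'F_p.
  by rewrite p_dvd dvdn_prime2 //; apply: contra_eq_neq p12 => ->.
have three_neq0: 3 != 0 :> 'F_p.
  by rewrite p_dvd dvdn_prime2 //; apply: contra_eq_neq p12 => ->.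
have B0: (1 + lam) * (lam - 2) * (1 - 2 * lam) != 0.
  rewrite !mulf_neq0 //; first by rewrite addrC addr_eq0.
    by rewrite subr_eq0.
  rewrite subr_eq0; apply: contra_neq lam_half => e.
  by apply: (mulfI two_neq0); rewrite -e divff.
have etaX := etaX eta1 etaM.
have conjE := eta_conj eta0 eta1 etaM eta12.
transitivity (\sum_y eta (y ^+ 5 / (1 - y) ^+ 5 /
  (1 - 27 * lam ^+ 2 * (lam - 1) ^+ 2 / (4 * (lam ^+ 2 - lam + 1) ^+ 3) * y))).
  apply: eq_bigr => y _; rewrite /cpow -!etaX !conjE [RHS]etaM; congr (_ * _).
  (* At [y = 1] both sides vanish, the right one through [eta 0]. *)
  rewrite /eps; case: eqP => [->|_]; last by rewrite mulr1 -etaM.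
  by rewrite expr0n invr0 !mulr0 eta0.
rewrite (order12_hypergeometric two_neq0 three_neq0 eta0 eta1 etaM eta12 etaO) //.
rewrite /cpow (_ : 1 - lam + lam ^+ 2 = lam ^+ 2 - lam + 1); last by ring.
congr (_ * _); apply: eq_bigr => y _; rewrite !(phiM etaM) -!qE -!mulrA.
have qconj x : (qchar x)^* = qchar x.
  rewrite /qchar; case: ifP => _; first exact: conjC0.
  by case: ifP => _; rewrite ?rmorphN1 ?rmorph1.
rewrite !qconj; congr (_ * _); rewrite mulrA; congr (_ * _).
by rewrite /eps /qchar; case: eqP => _; rewrite ?mul0r ?mulr1.
Qed.
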